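(* Let $V\in\mathbb{R}^{n\times r}$ be an orthonormal basis (that is, $V$ has orthonormal columns) and let $I$ be the random index set of cardinality $r$ returned by Adaptive Randomized Pivoting (ARP) applied to $V$. Then, for an arbitrary but fixed vector $f\in\mathbb{R}^n$, $$\mathbb{E}[\|f-V(E_I^TV)^{-1}E_I^Tf\|_2^2]\le (r+1)\,\|f-VV^Tf\|_2^2 .$$ Moreover, $$\mathbb{E}[\|(E_I^TV)^{-1}\|_F^2]= r(n-r+1),\qquad \mathbb{E}[\|(E_I^TV)^{-1}\|_2^2]\le r(n-r)+1 .$$
   Context: $\|\cdot\|_F$ is the Frobenius norm; $\|\cdot\|_2$ is the Euclidean norm of a vector and the spectral norm of a matrix. For $I=(i_1,\ldots,i_r)$, $E_I=[e_{i_1},\ldots,e_{i_r}]\in\mathbb{R}^{n\times r}$ with $e_i$ the $i$th unit vector, so that $E_I^TV=V(I,:)$ is the submatrix of rows of $V$ indexed by $I$. The expectation is over the random choice of $I$. Adaptive Randomized Pivoting (ARP). Input: $V\in\mathbb{R}^{n\times r}$ with orthonormal columns. Set $W_0=V$. For $k=1,\ldots,r$: set $p_j=\|W_{k-1}(j,k:r)\|_2^2/(r-k+1)$ for $j=1,\ldots,n$ (a probability distribution on $\{1,\dots,n\}$), where $W_{k-1}(j,k:r)$ is row $j$ restricted to columns $k,\ldots,r$; sample an index $i_k$ according to the probabilities $p_j$ (conditionally on $i_1,\ldots,i_{k-1}$); set $W_k=W_{k-1}Q_k$, where $Q_k=\mathrm{diag}(\mathrm{Id}_{k-1},H_k)\in\mathbb{R}^{r\times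 r}$ and $H_k=\mathrm{Id}_{r-k+1}-2u_ku_k^T$ is a Householder reflector, with a unit vector $u_k\in\mathbb{R}^{r-k+1}$ chosen such that $W_{k-1}(i_k,k:r)H_k$ is a multiple of the first unit row vector, i.e. $W_k(i_k,k+1:r)=0$. Output: $I=(i_1,\ldots,i_r)$. With probability one, the indices are distinct and $V(I,:)$ is invertible.
   Formalization: The Frobenius equality fails in general (n=2, r=1, V=(1,0)^T gives 1, not 2); it is proved as ≤ r(n-r+1) for every V, and with equality exactly when no r distinct rows of V form a matrix of rank r-1. *)

(* Defs.v *)
From mathcomp Require Import all_boot all_order all_algebra.
From mathcomp Require Import all_classical all_reals all_analysis.

Set Implicit Arguments.
Unset Strict Implicit.
Unset Printing Implicit Defensive.

Import Order.TTheory GRing.Theory Num.Theory.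

Local Open Scope classical_set_scope.
Local Open Scope ring_scope.

Definition norm2 (R : realType) (n : nat) (x : 'cV[R]_n) : R :=
  Num.sqrt (\sum_(i < n) x i ord0 ^+ 2).

Definition normF (R : realType) (m n : nat) (A : 'M[R]_(m, n)) : R :=
  Num.sqrt (\sum_(i < m) \sum_(j < n) A i j ^+ 2).

(* The supremum runs over the closed unit ball, not the unit sphere, so that
   the set is nonempty (and the norm is 0) also when n = 0. *)
Definition specnorm (R : realType) (m n : nat) (A : 'M[R]_(m, n)) : R :=
  sup [set norm2 (A *m x) | x in [set x : 'cV[R]_n | norm2 x <= 1]].

(* E_I = [e_{i_1}, ..., e_{i_r}] *)
Definition unit_cols (R : realType) (n r : nat) (I : r.-tuple 'I_n) :
    'M[R]_(n, r) :=
  \matrix_(i < n, k < r) (i == tnth I k)%:R.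

(* Q = diag(Id_k, Id_{r-k} - 2 u u^T). Steps are numbered from 0: k : 'I_r is
   step k + 1 of the algorithm, and "columns k+1, ..., r" are the column
   indices l with k <= l. *)
Definition householder_step (R : realType) (r : nat) (k : 'I_r)
    (u : 'cV[R]_(r - k)) : 'M[R]_r :=
  let e : (k + (r - k))%N = r := subnKC (ltnW (ltn_ord k)) in
  castmx (e, e) (block_mx 1%:M 0 0 (1%:M - 2%:R *: (u *m u^T))).

Definition pivot_prob (R : realType) (n r : nat) (W : 'M[R]_(n, r))
    (k : 'I_r) (j : 'I_n) : R :=
  (\sum_(l < r | (k <= l)%N) W j l ^+ 2) / (r - k)%:R.

(* [is_ARP P V I u W] says that, on the probability space P, the random tuple I
   is produced by adaptive randomized pivoting applied to V, with Householder
   vectors u and intermediate matrices W.  As u is only constrained by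
   [arp_unit] and [arp_pivot], every admissible way of choosing the reflectors
   is covered.  In [arp_sample], the outcome w0 fixes the history
   (i_1, ..., i_k), and the equation is
     Pr(i_{k+1} = j | i_1, ..., i_k) = p_j
   in product form, which avoids dividing by the probability of the history. *)
Record is_ARP (d : measure_display) (T : measurableType d) (R : realType)
    (P : probability T R) (n r : nat) (V : 'M[R]_(n, r))
    (I : T -> r.-tuple 'I_n) (u : forall k : 'I_r, T -> 'cV[R]_(r - k))
    (W : nat -> T -> 'M[R]_(n, r)) : Prop := IsARP {
  arp_measurable : forall J : r.-tuple 'I_n, measurable (I @^-1` [set J]);
  arp_init : forall w, W 0%N w = V;
  arp_sample : forall (k : 'I_r) (j : 'I_n) (w0 : T),
    P [set w | take k (I w) = take k (I w0) /\ tnth (I w) k = j] =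
    (P [set w | take k (I w) = take k (I w0)] *
     (pivot_prob (W k w0) k j)%:E)%E;
  arp_unit : forall (k : 'I_r) w, norm2 (u k w) = 1;
  arp_step : forall (k : 'I_r) w,
    W k.+1 w = W k w *m householder_step (u k w);
  arp_pivot : forall (k l : 'I_r) w,
    (k < l)%N -> W k.+1 w (tnth (I w) k) l = 0
}.

(* No r distinct rows of V form a matrix of rank exactly r - 1; in particular
   this holds when any r distinct rows are linearly independent.  The identity
     E ||(E_I^T V)^-1||_F^2 = r (n - r + 1)
   requires it: the index sets with det V(I,:) = 0 have probability zero, but
   the identity sums ||adj V(I,:)||_F^2 over all index sets, and adj V(I,:) is
   nonzero for a singular V(I,:) exactly when its rank is r - 1.  For example,
   n = 2, r = 1, V = (1, 0)^T gives expectation 1, not 2. *)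
Definition no_corank1_rows (R : realType) (n r : nat) (V : 'M[R]_(n, r)) :
    Prop :=
  forall J : r.-tuple 'I_n, uniq J ->
    (\rank ((unit_cols R J)^T *m V)).+1 <> r.

(* Main.v *)
Require Import Defs.
From mathcomp Require Import all_boot all_order perm all_algebra.
From mathcomp Require Import all_classical all_reals all_analysis.
From mathcomp Require Import measurable_realfun ring.

(* The reflectors make the rows of [W r] indexed by the sampled pivots lower
   triangular, and the sampling probabilities are the squared diagonal entries
   divided by r, r - 1, ..., 1.  Hence I has the volume-sampling law
     P(I = J) = det(V_J)^2 / r!,
   and the factor det(V_J)^2 turns inverses into adjugates, so every expectation
   becomes a sum of squared minors, evaluated by the Cauchy-Binet formula.
   - By Cramer's rule, det(V_J)^2 |V_J^-1 g_J|^2 is the sum over i of the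
     det(V'_J)^2, where V' is V with column i replaced by g = f - V V^T f; as
     V^T g = 0, each i contributes r! |g|^2.
   - |adj V_J|_F = |V adj V_J|_F, and the entries of V adj V_J are the
     determinants det(V_K) with K obtained from J by changing one index;
     exchanging the old and the new index, each K arises r (n - r + 1) times.
   - The rows of V V_J^-1 indexed by J form the identity, which accounts for r
     in the squared Frobenius norm but only for 1 in the squared spectral
     norm. *)

Set Implicit Arguments.
Unset Strict Implicit.
Unset Printing Implicit Defensive.

Import Order.TTheory GRing.Theory Num.Theory.

Local Open Scope classical_set_scope.
Local Open Scope ring_scope.

(** * Cauchy-Binet formula and Cramer's rule *)

(** Cauchy-Binet over all maps [J], not only increasing ones, which produces the factor r!. Both
    determinants are expanded over permutations s and t; the sum over [J] of the product over k
    becomes a product of entries of [G] at (s k, t k). For each s the sum over t is then [\det G],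
    because the sign of s cancels that of the row permutation. *)
Lemma sum_det_rowsub (R : comNzRingType) (n r : nat) (M N : 'M[R]_(n, r)) :
  \sum_(J : {ffun 'I_r -> 'I_n}) \det (rowsub J M) * \det (rowsub J N) =
  r`!%:R * \det (M^T *m N).
Proof.
set G := M^T *m N.
transitivity (\sum_(s : {perm 'I_r}) \sum_(t : {perm 'I_r})
   \sum_(J : {ffun 'I_r -> 'I_n})
   (-1) ^+ s * ((-1) ^+ t * \prod_k (M (J k) (s k) * N (J k) (t k)))).
  transitivity (\sum_(J : {ffun 'I_r -> 'I_n}) \sum_(s : {perm 'I_r})
      \sum_(t : {perm 'I_r})
      (-1) ^+ s * ((-1) ^+ t * \prod_k (M (J k) (s k) * N (J k) (t k)))).
    apply: eq_bigr => J _; rewrite /determinant big_distrlr /=.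
    apply: eq_bigr => s _; apply: eq_bigr => t _.
    rewrite mulrACA -mulrA -big_split /=; congr (_ * (_ * _)).
    by apply: eq_bigr => k _; rewrite !mxE.
  rewrite exchange_big /=; apply: eq_bigr => s _.
  by rewrite exchange_big.
have step (s : {perm 'I_r}) : \sum_(t : {perm 'I_r}) \sum_(J : {ffun 'I_r -> 'I_n})
   (-1) ^+ s * ((-1) ^+ t * \prod_k (M (J k) (s k) * N (J k) (t k))) = \det G.
  transitivity ((-1) ^+ s * \det (row_perm s G)).
    rewrite /determinant mulr_sumr; apply: eq_bigr => t _.
    rewrite -!mulr_sumr; congr (_ * (_ * _)).
    rewrite -(bigA_distr_bigA (fun k a => M a (s k) * N a (t k))) /=.
    by apply: eq_bigr => k _; rewrite !mxE; apply: eq_bigr => a _; rewrite mxE.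
  by rewrite row_permE det_mulmx det_perm mulrA -signr_addb addbb mul1r.
by rewrite (eq_bigr _ (fun s _ => step s)) sumr_const card_Sn mulr_natl.
Qed.

Definition replace_row (R : Type) (m n : nat) (A : 'M[R]_(m, n)) (i : 'I_m)
    (x : 'rV[R]_n) : 'M[R]_(m, n) :=
  \matrix_(k, l) if k == i then x 0 l else A k l.

Definition replace_col (R : Type) (m n : nat) (A : 'M[R]_(m, n)) (i : 'I_n)
    (x : 'cV[R]_m) : 'M[R]_(m, n) :=
  \matrix_(k, l) if l == i then x k 0 else A k l.

(** Expansion along row i: the cofactors of that row do not see the row itself. *)
Lemma mulmx_adj_row (R : comNzRingType) (r : nat) (A : 'M[R]_r) (i : 'I_r)
    (x : 'rV[R]_r) :
  (x *m \adj A) 0 i = \det (replace_row A i x).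
Proof.
rewrite (expand_det_row _ i) mxE; apply: eq_bigr => l _.
rewrite !mxE eqxx; congr (_ * (_ * \det _)).
by apply/matrixP => a b; rewrite !mxE eq_sym (negbTE (neq_lift _ _)).
Qed.

Lemma mulmx_adj_col (R : comNzRingType) (r : nat) (A : 'M[R]_r) (i : 'I_r)
    (x : 'cV[R]_r) :
  (\adj A *m x) i 0 = \det (replace_col A i x).
Proof.
rewrite (expand_det_col _ i) mxE; apply: eq_bigr => l _.
rewrite !mxE eqxx mulrC; congr (_ * (_ * \det _)).
apply/matrixP => a b; rewrite !mxE.
by rewrite [X in if X then _ else _]eq_sym (negbTE (neq_lift _ _)).
Qed.


(** * Orthogonality of the Householder steps *)

Section Householder.
Context (R : realType) (r : nat) (k : 'I_r) (u : 'cV[R]_(r - k)).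

Lemma householder_step_col (i l : 'I_r) :
  (l < k)%N -> householder_step u i l = (i == l)%:R.
Proof.
rewrite /householder_step; set e := subnKC _ => lk.
rewrite castmxE /=; set i' := cast_ord _ i; set l' := cast_ord _ l.
have -> : (i == l) = (i' == l') by rewrite -!val_eqE.
have -> : l' = lshift (r - k) (Ordinal lk) by apply: val_inj.
case: (split_ordP i') => j ->; first by rewrite block_mxEul mxE eq_lshift.
by rewrite block_mxEdl mxE eq_rlshift.
Qed.

Lemma mul_householder_stepT :
  norm2 u = 1 -> householder_step u *m (householder_step u)^T = 1%:M.
Proof.
move=> u1; rewrite /householder_step; set e := subnKC _.
have uu : u^T *m u = 1%:M.
  apply/matrixP => a b; rewrite !ord1 mxE mxE eqxx.
  have : norm2 u ^+ 2 = 1 by rewrite u1 expr1n.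
  rewrite sqr_sqrtr ?sumr_ge0// => [<-|*]; last exact: sqr_ge0.
  by apply: eq_bigr => c _; rewrite mxE expr2.
(* With a variable size m, eliminating [em] makes the cast trivial. *)
have cast_orth m (em : m = r) (B : 'M[R]_m) :
    B *m B^T = 1%:M -> castmx (em, em) B *m (castmx (em, em) B)^T = 1%:M.
  by case: r / em.
apply: cast_orth; rewrite tr_block_mx mulmx_block.
rewrite !(trmx0, trmx1, mulmx0, mul0mx, mulmx1, addr0, add0r).
set U := u *m u^T.
have UT : U^T = U by rewrite trmx_mul trmxK.
have UU : U *m U = U by rewrite mulmxA -(mulmxA u) uu mulmx1.
have -> : (1%:M - 2%:R *: U) *m (1%:M - 2%:R *: U)^T = 1%:M.
  rewrite [(_ - _)^T]linearB /= [(_ *: _)^T]linearZ /= trmx1 UT.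
  rewrite mulmxBl mul1mx mulmxBr mulmx1 -scalemxAl -scalemxAr UU.
  by rewrite [2%:R *: (2%:R *: U)]scaler_nat mulr2n opprB addrK subrK.
by rewrite -scalar_mx_block.
Qed.
End Householder.

(** * Triangular structure and the probability of an attained index tuple *)

Section ARP.
Context (R : realType) (d : measure_display) (T : measurableType d).
Context (P : probability T R) (n r : nat) (V : 'M[R]_(n, r)).
Context (I : T -> r.-tuple 'I_n) (u : forall k : 'I_r, T -> 'cV[R]_(r - k)).
Context (W : nat -> T -> 'M[R]_(n, r)) (hI : is_ARP P V I u W).

(** Every step is a right multiplication by an orthogonal matrix. The invariance carries squared
    minors from [V] over to the final [W r]. *)
Lemma arp_gram m w : (m <= r)%N -> W m w *m (W m w)^T = V *m V^T.
Proof.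
elim: m => [|m IHm] mr; first by rewrite (arp_init hI).
rewrite (arp_step hI (Ordinal mr)) trmx_mul mulmxA -(mulmxA (W m w)).
by rewrite mul_householder_stepT ?(arp_unit hI)// mulmx1 IHm// ltnW.
Qed.

Lemma arp_step_col (k l : 'I_r) w j :
  (l < k)%N -> W k.+1 w j l = W k w j l.
Proof.
move=> lk; rewrite (arp_step hI) mxE (bigD1 l)//= householder_step_col// eqxx.
rewrite mulr1 big1 ?addr0// => i il.
by rewrite householder_step_col// (negbTE il) mulr0.
Qed.

(** The norm of the whole row is invariant, and step k leaves the columns before k alone. *)
Lemma arp_step_tail (k : 'I_r) w j :
  \sum_(l < r | (k <= l)%N) W k.+1 w j l ^+ 2 =
  \sum_(l < r | (k <= l)%N) W k w j l ^+ 2.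
Proof.
have rowE m : (m <= r)%N -> \sum_l W m w j l ^+ 2 = (V *m V^T) j j.
  move=> mr; rewrite -(arp_gram w mr) mxE.
  by apply: eq_bigr => l _; rewrite mxE expr2.
have := rowE _ (ltn_ord k); rewrite -(rowE _ (ltnW (ltn_ord k))).
rewrite (bigID (fun l : 'I_r => (k <= l)%N))/=.
rewrite [RHS](bigID (fun l : 'I_r => (k <= l)%N))/=.
rewrite (eq_bigr (F1 := fun l : 'I_r => W k.+1 w j l ^+ 2)
  (P := fun l : 'I_r => ~~ (k <= l)%N) (fun l => W k w j l ^+ 2)).
  exact: addIr.
by move=> l; rewrite -ltnNge => lk; rewrite arp_step_col.
Qed.

Lemma arp_col (l : 'I_r) m w j :
  (l < m <= r)%N -> W m w j l = W l.+1 w j l.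
Proof.
elim: m => // m IHm /andP[]; rewrite ltnS leq_eqVlt => /orP[/eqP<-//|lm mr].
by rewrite (@arp_step_col (Ordinal mr)) ?IHm// lm ltnW.
Qed.

(** Zeros of a pivot row persist: step m does not touch columns before m, and in the columns from m
    on the row has norm zero, which the reflection preserves. *)
Lemma arp_pivot_col (k l : 'I_r) m w :
  (k < l)%N -> (k < m <= r)%N -> W m w (tnth (I w) k) l = 0.
Proof.
elim: m l => // m IHm l kl /andP[]; rewrite ltnS leq_eqVlt.
case/orP => [/eqP<- _|km mr]; first exact: (arp_pivot hI).
case: (ltnP l m) => lm.
  by rewrite (@arp_step_col (Ordinal mr)) ?IHm// km ltnW.
have /eqP := arp_step_tail (Ordinal mr) w (tnth (I w) k).
rewrite [X in _ == X]big1 => [|i /= mi]; last first.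
  by rewrite IHm ?expr0n// ?km ?(ltnW mr)// (leq_trans km).
rewrite psumr_eq0 => [|i _]; last exact: sqr_ge0.
by move=> /allP/(_ l (mem_index_enum _))/=; rewrite lm sqrf_eq0 => /eqP.
Qed.

(** The reflection concentrates the tail of the pivot row in column k, which no later step
    changes. *)
Lemma arp_pivot_prob (k : 'I_r) w :
  pivot_prob (W k w) k (tnth (I w) k) =
  W r w (tnth (I w) k) k ^+ 2 / (r - k)%:R.
Proof.
congr (_ / _); rewrite -arp_step_tail (bigD1 k)//= big1 => [|l /andP[kl lk]].
  by rewrite addr0 [in RHS]arp_col// ltn_ord leqnn.
by rewrite (arp_pivot hI) ?expr0n// ltn_neqAle eq_sym lk.
Qed.

(** Chain rule for the conditional probabilities along the history of [w0]. *)
Lemma arp_prob_prefix m w0 : (m <= r)%N ->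
  P [set w | take m (I w) = take m (I w0)] =
  (\prod_(k < r | (k < m)%N) pivot_prob (W k w0) k (tnth (I w0) k))%:E.
Proof.
elim: m => [_|m IHm mr].
  rewrite big_pred0 ?ltn0// -[RHS](probability_setT P); congr (P _).
  by apply/seteqP; split => // w _ /=; rewrite !take0.
pose k := Ordinal mr.
transitivity (P [set w | take k (I w) = take k (I w0) /\
                         tnth (I w) k = tnth (I w0) k]).
  have x0 : 'I_n := tnth (I w0) k.
  have takeS w : take m.+1 (I w) = rcons (take k (I w)) (tnth (I w) k).
    by rewrite (tnth_nth x0) (take_nth x0) ?size_tuple.
  congr (P _); apply/seteqP; split => w /=; rewrite !takeS.
    by move=> /rcons_inj[].
  by move=> [-> ->].
rewrite (arp_sample hI) IHm ?(ltnW mr)// -EFinM; congr EFin.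
rewrite [in RHS](bigD1 k)//= mulrC; congr (_ * _); apply: eq_bigl => l.
by rewrite ltnS ltn_neqAle andbC.
Qed.

Lemma arp_prob w0 :
  P (I @^-1` [set I w0]) =
  (\det (rowsub (tnth (I w0)) V) ^+ 2 / r`!%:R)%:E.
Proof.
have -> : I @^-1` [set I w0] = [set w | take r (I w) = take r (I w0)].
  apply/seteqP; split => w /= => [->//|].
  by rewrite !take_oversize ?size_tuple// => /val_inj.
rewrite arp_prob_prefix//; congr EFin.
under eq_bigl do rewrite ltn_ord.
under eq_bigr do rewrite arp_pivot_prob.
rewrite big_split/= prodfV; congr (_ / _).
  rewrite prodrXl.
  have -> : \prod_k W r w0 (tnth (I w0) k) k =
            \det (rowsub (tnth (I w0)) (W r w0)).
    rewrite det_trig; first by apply: eq_bigr => k _; rewrite mxE.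
    by apply/is_trig_mxP => i j ij; rewrite mxE arp_pivot_col// ltn_ord leqnn.
  (* A squared minor is a principal minor of the Gram matrix [M *m M^T], hence the same for [V] and
     [W r]. *)
  have detE (M : 'M[R]_(n, r)) : \det (rowsub (tnth (I w0)) M) ^+ 2 =
      \det (mxsub (tnth (I w0)) (tnth (I w0)) (M *m M^T)).
    rewrite expr2 -[X in _ * X]det_tr -det_mulmx; congr (\det _).
    by apply/matrixP => i j; rewrite !mxE; apply: eq_bigr => k _; rewrite !mxE.
  by rewrite !detE arp_gram.
rewrite -natr_prod (reindex_inj rev_ord_inj)/=; congr (_%:R).
rewrite fact_prod big_add1 big_mkord; apply: eq_bigr => i _.
by rewrite subKn.
Qed.

End ARP.

(** * Expectations under the volume-sampling law *)

(** The integrand is a finite nonnegative combination of indicators of the fibres of [I], so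
    measurable fibres suffice. *)
Lemma expectation_comp_fin (d : measure_display) (T : measurableType d)
    (R : realType) (P : probability T R) (X : finType) (I : T -> X)
    (F : X -> R) :
  (forall x, measurable (I @^-1` [set x])) -> (forall x, 0 <= F x) ->
  ('E_P[fun w => F (I w)] = \sum_x (F x)%:E * P (I @^-1` [set x]))%E.
Proof.
move=> mI F0; rewrite unlock.
under eq_integral => w _.
  rewrite (_ : (F (I w))%:E =
    \sum_x (F x)%:E * (\1_(I @^-1` [set x]) w)%:E)%E; last first.
    rewrite (bigD1 (I w))//= big1 ?adde0 => [|x xI].
      by rewrite indicE mem_set// mule1.
    by rewrite indicE memNset ?mule0//= => /esym/eqP; apply/negP.
  over.
rewrite ge0_integral_sum//=.
- apply: eq_bigr => x _; rewrite ge0_integralZl ?lee_fin//=.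
  + by rewrite integral_indic// setIT.
  + by apply/measurable_EFinP; exact: measurable_indic.
- move=> x; apply: measurable_funeM; apply/measurable_EFinP.
  exact: measurable_indic.
- by move=> x w _; rewrite mule_ge0// lee_fin.
Qed.

Lemma rowsub_mktuple (R : Type) (n r p : nat) (J : {ffun 'I_r -> 'I_n})
    (M : 'M[R]_(n, p)) :
  rowsub (tnth (mktuple J)) M = rowsub J M.
Proof. by apply/matrixP => i j; rewrite !mxE tnth_mktuple. Qed.

Lemma mul_tr_unit_cols (R : realType) (n r p : nat) (J : r.-tuple 'I_n)
    (M : 'M[R]_(n, p)) :
  (unit_cols R J)^T *m M = rowsub (tnth J) M.
Proof.
apply/matrixP => i j; rewrite !mxE (bigD1 (tnth J i))//= !mxE eqxx mul1r.
by rewrite big1 ?addr0// => a aJ; rewrite !mxE (negbTE aJ) mul0r.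
Qed.

Lemma sum_tuple_ffun (R : nmodType) (n r : nat) (F : r.-tuple 'I_n -> R) :
  \sum_J F J = \sum_(J : {ffun 'I_r -> 'I_n}) F (mktuple J).
Proof.
apply: (reindex (fun J : {ffun 'I_r -> 'I_n} => mktuple J)).
exists (fun t : r.-tuple 'I_n => [ffun i => tnth t i]) => [J _|t _].
  by apply/ffunP => i; rewrite ffunE tnth_mktuple.
by apply/eq_from_tnth => i; rewrite tnth_mktuple ffunE.
Qed.

(** Says that the weights det(V_J)^2 / r! have total mass 1. *)
Lemma sum_det_sqr (R : realType) (n r : nat) (V : 'M[R]_(n, r)) :
  V^T *m V = 1%:M ->
  \sum_(J : {ffun 'I_r -> 'I_n}) \det (rowsub J V) ^+ 2 = r`!%:R.
Proof.
move=> hV; under eq_bigr do rewrite expr2.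
by rewrite sum_det_rowsub hV det1 mulr1.
Qed.

Section ARPLaw.
Context (R : realType) (d : measure_display) (T : measurableType d).
Context (P : probability T R) (n r : nat) (V : 'M[R]_(n, r)).
Context (hV : V^T *m V = 1%:M).
Context (I : T -> r.-tuple 'I_n) (u : forall k : 'I_r, T -> 'cV[R]_(r - k)).
Context (W : nat -> T -> 'M[R]_(n, r)) (hI : is_ARP P V I u W).

(* [arp_prob] covers the tuples in the range of [I].  The others have
   probability 0, and their determinants vanish because both sides sum to 1. *)
Lemma arp_law (J : r.-tuple 'I_n) :
  P (I @^-1` [set J]) = (\det (rowsub (tnth J) V) ^+ 2 / r`!%:R)%:E.
Proof.
pose q J := \det (rowsub (tnth J) V) ^+ 2 / r`!%:R.
pose p J := fine (P (I @^-1` [set J])).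
have pE K : P (I @^-1` [set K]) = (p K)%:E.
  by rewrite fineK// fin_num_measure//; exact: (arp_measurable hI).
have q0 K : 0 <= q K by rewrite divr_ge0 ?sqr_ge0.
have pq K : p K <= q K.
  have [[w <-]|nK] := pselect (exists w, I w = K).
    by rewrite -lee_fin -pE (arp_prob hI).
  rewrite -lee_fin -pE (_ : _ @^-1` _ = set0) ?measure0 ?lee_fin//.
  by apply/seteqP; split=> // w /= Iw; case: nK; exists w.
have sp : \sum_K p K = 1.
  apply: EFin_inj; rewrite -sumEFin -(expectation_cst P 1).
  rewrite (expectation_comp_fin P (arp_measurable hI) (fun=> ler01 : 0 <= 1 :> R)).
  by apply: eq_bigr => K _; rewrite mul1e -pE.
have sq : \sum_K q K = 1.
  rewrite sum_tuple_ffun; under eq_bigr do rewrite /q rowsub_mktuple.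
  by rewrite -mulr_suml sum_det_sqr// divff// pnatr_eq0 -lt0n fact_gt0.
have /eqP : \sum_K (q K - p K) = 0 by rewrite sumrB sp sq subrr.
rewrite psumr_eq0 => [|K _]; last by rewrite subr_ge0.
move=> /allP/(_ J (mem_index_enum _)); rewrite subr_eq0 => /eqP qp.
by rewrite pE -qp.
Qed.

Lemma arp_expectation (F : r.-tuple 'I_n -> R) :
  (forall J, 0 <= F J) ->
  'E_P[fun w => F (I w)]%E =
  ((\sum_(J : {ffun 'I_r -> 'I_n}) F (mktuple J) * \det (rowsub J V) ^+ 2)
    / r`!%:R)%:E.
Proof.
move=> F0; rewrite (expectation_comp_fin P (arp_measurable hI) F0).
rewrite mulr_suml -sumEFin (sum_tuple_ffun (R := \bar R)).
by apply: eq_bigr => J _; rewrite arp_law rowsub_mktuple -EFinM mulrA.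
Qed.

End ARPLaw.

(** * Euclidean, Frobenius and spectral norms *)

Section Norms.
Context (R : realType).

Lemma norm2_sqr n (x : 'cV[R]_n) : norm2 x ^+ 2 = \sum_i x i 0 ^+ 2.
Proof. by rewrite sqr_sqrtr// sumr_ge0// => i _; exact: sqr_ge0. Qed.

Lemma norm2_sqrE n (x : 'cV[R]_n) : norm2 x ^+ 2 = (x^T *m x) 0 0.
Proof.
by rewrite norm2_sqr mxE; apply: eq_bigr => i _; rewrite mxE expr2.
Qed.

Lemma normF_sqr m n (A : 'M[R]_(m, n)) :
  normF A ^+ 2 = \sum_i \sum_j A i j ^+ 2.
Proof.
by rewrite sqr_sqrtr// !sumr_ge0// => i _; rewrite sumr_ge0// => j _; exact: sqr_ge0.
Qed.

Lemma normF_sqrE m n (A : 'M[R]_(m, n)) : normF A ^+ 2 = \tr (A^T *m A).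
Proof.
rewrite normF_sqr exchange_big; apply: eq_bigr => j _; rewrite mxE.
by apply: eq_bigr => i _; rewrite mxE expr2.
Qed.

Lemma orthonormal_norm2 m n (V : 'M[R]_(m, n)) (x : 'cV[R]_n) :
  V^T *m V = 1%:M -> norm2 (V *m x) ^+ 2 = norm2 x ^+ 2.
Proof.
by move=> hV; rewrite !norm2_sqrE trmx_mul mulmxA -(mulmxA x^T) hV mulmx1.
Qed.

Lemma orthonormal_normF m n p (V : 'M[R]_(m, n)) (A : 'M[R]_(n, p)) :
  V^T *m V = 1%:M -> normF (V *m A) ^+ 2 = normF A ^+ 2.
Proof.
by move=> hV; rewrite !normF_sqrE trmx_mul mulmxA -(mulmxA A^T) hV mulmx1.
Qed.

Lemma normFZ m n (a : R) (A : 'M[R]_(m, n)) :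
  normF (a *: A) ^+ 2 = a ^+ 2 * normF A ^+ 2.
Proof.
rewrite !normF_sqr mulr_sumr; apply: eq_bigr => i _; rewrite mulr_sumr.
by apply: eq_bigr => j _; rewrite mxE exprMn.
Qed.

Lemma specnorm_sqr_le m n (A : 'M[R]_(m, n)) (c : R) :
  (forall x, norm2 x <= 1 -> norm2 (A *m x) ^+ 2 <= c) ->
  specnorm A ^+ 2 <= c.
Proof.
(* The zero vector makes the set under the supremum nonempty and forces [c] to be nonnegative. *)
move=> Ac; have z1 : norm2 (0 : 'cV[R]_n) <= 1.
  by rewrite /norm2 big1 ?sqrtr0// => i _; rewrite mxE expr0n.
have c0 : 0 <= c by apply: le_trans (Ac _ z1); exact: sqr_ge0.
have ub : ubound [set norm2 (A *m x) | x in [set x | norm2 x <= 1]] (Num.sqrt c).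
  move=> _ [x /= x1 <-].
  by rewrite -[leLHS](ger0_norm (sqrtr_ge0 _)) -sqrtr_sqr ler_wsqrtr// Ac.
have s0 : 0 <= specnorm A.
  apply: (le_trans (sqrtr_ge0 _)); apply: ub_le_sup; first by exists (Num.sqrt c).
  by exists 0.
rewrite -[leRHS](sqr_sqrtr c0) lerXn2r ?nnegrE ?sqrtr_ge0//.
by apply: ge_sup => //; exists (norm2 (A *m 0)); exists 0.
Qed.

(** Lagrange's identity: twice the gap is a double sum of squares. *)
Lemma cauchy_schwarz_sum n (a b : 'I_n -> R) :
  (\sum_i a i * b i) ^+ 2 <= (\sum_i a i ^+ 2) * (\sum_i b i ^+ 2).
Proof.
have : 0 <= \sum_i \sum_j (a i * b j - a j * b i) ^+ 2.
  by apply: sumr_ge0 => i _; apply: sumr_ge0 => j _; exact: sqr_ge0.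
suff -> : \sum_i \sum_j (a i * b j - a j * b i) ^+ 2 =
   ((\sum_i a i ^+ 2) * (\sum_i b i ^+ 2) - (\sum_i a i * b i) ^+ 2) *+ 2.
  by rewrite pmulrn_lge0// subr_ge0.
under eq_bigr => i _.
  under eq_bigr => j _.
    rewrite (_ : _ ^+ 2 = (a i ^+ 2 * b j ^+ 2 + b i ^+ 2 * a j ^+ 2) -
      ((a i * b i) * (a j * b j)) *+ 2); last by ring.
    over.
  rewrite sumrB big_split/= sumrMnl -!mulr_sumr.
  over.
rewrite sumrB big_split/= sumrMnl -!mulr_suml.
by ring.
Qed.

End Norms.

(** * Error of the oblique projection *)

Lemma det_rowsub_injective (R : comNzRingType) (n r : nat) (V : 'M[R]_(n, r))
    (J : 'I_r -> 'I_n) :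
  \det (rowsub J V) != 0 -> injective J.
Proof.
move=> dJ i j Jij; apply/eqP/negPn/negP => ij; move/eqP: dJ; apply.
by apply: (determinant_alternate ij) => l; rewrite !mxE Jij.
Qed.

(** The columns stay orthogonal after the replacement, so the Gram matrix is diagonal, with |g|^2 in
    place i and 1 elsewhere. *)
Lemma sum_det_replace_col (R : realType) (n r : nat) (V : 'M[R]_(n, r))
    (g : 'cV[R]_n) (i : 'I_r) :
  V^T *m V = 1%:M -> V^T *m g = 0 ->
  \sum_(J : {ffun 'I_r -> 'I_n}) \det (rowsub J (replace_col V i g)) ^+ 2 =
  r`!%:R * norm2 g ^+ 2.
Proof.
move=> hV hg; under eq_bigr do rewrite expr2.
rewrite sum_det_rowsub; congr (_ * _).
have -> : (replace_col V i g)^T *m replace_col V i g =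
    diag_mx (\row_l if l == i then norm2 g ^+ 2 else 1).
  have gV l : \sum_a V a l * g a 0 = 0.
    move/matrixP/(_ l 0): hg; rewrite !mxE => hg.
    by rewrite -[RHS]hg; apply: eq_bigr => a _; rewrite mxE.
  apply/matrixP => k l; rewrite !mxE.
  under eq_bigr do rewrite !mxE.
  have [->|ki] := eqVneq k i; have [li|li] := eqVneq l i.
  - by rewrite mulr1n norm2_sqr; apply: eq_bigr => a _; rewrite expr2.
  - by rewrite mulr0n -[RHS](gV l); apply: eq_bigr => a _; rewrite mulrC.
  - by rewrite li (negbTE ki) mulr0n gV.
  - move/matrixP/(_ k l): hV; rewrite !mxE => <-.
    by apply: eq_bigr => a _; rewrite mxE.
rewrite det_diag (bigD1 i)//= mxE eqxx big1 ?mulr1// => l li.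
by rewrite mxE (negbTE li).
Qed.

(** The oblique projection reproduces the range of [V], so [f] has the same error as its residual
    [g], namely g - V y with y = V_J^-1 g_J. As [g] is orthogonal to that range, Pythagoras splits
    the error, and Cramer's rule turns each det(V_J) y_i into a minor. Only a singular V_J, where
    the left side is 0, can make the inequality strict. *)
Lemma oblique_projection_bound (R : realType) (n r : nat) (V : 'M[R]_(n, r))
    (J : {ffun 'I_r -> 'I_n}) (f : 'cV[R]_n) :
  let g := f - V *m V^T *m f in
  V^T *m V = 1%:M ->
  norm2 (f - V *m invmx (rowsub J V) *m rowsub J f) ^+ 2 *
    \det (rowsub J V) ^+ 2 <=
  norm2 g ^+ 2 * \det (rowsub J V) ^+ 2 +
  \sum_i \det (rowsub J (replace_col V i g)) ^+ 2.
Proof.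
move=> g hV; set A := rowsub J V.
have hg : V^T *m g = 0 by rewrite mulmxBr !mulmxA hV mul1mx subrr.
have [dA|dA] := eqVneq (\det A) 0.
  rewrite dA expr0n/= !mulr0 add0r; apply: sumr_ge0 => i _; exact: sqr_ge0.
have uA : A \in unitmx by rewrite unitmxE unitfE.
pose y := invmx A *m rowsub J g.
have -> : f - V *m invmx A *m rowsub J f = g - V *m y.
  have -> : rowsub J f = rowsub J g + A *m (V^T *m f).
    rewrite mul_rowsub_mx mulmxA -{1}(subrK (V *m V^T *m f) f) -/g.
    by apply/matrixP => i j; rewrite !mxE.
  rewrite mulmxDr -[V *m invmx A *m (A *m _)]mulmxA (mulKmx uA).
  by rewrite /y /g opprD !mulmxA [RHS]addrAC addrA.
clearbody g; have -> : norm2 (g - V *m y) ^+ 2 = norm2 g ^+ 2 + norm2 y ^+ 2.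
  rewrite -(orthonormal_norm2 y hV) !norm2_sqrE.
  rewrite [(_ - _)^T]linearB/= mulmxBl !mulmxBr.
  have -> : g^T *m (V *m y) = 0.
    by rewrite mulmxA -[g^T *m V]trmxK trmx_mul trmxK hg trmx0 mul0mx.
  have -> : (V *m y)^T *m g = 0 by rewrite trmx_mul -mulmxA hg mulmx0.
  by rewrite subr0 sub0r opprK mxE.
rewrite mulrDl lerD2l [X in X * _]norm2_sqr mulr_suml le_eqVlt; apply/orP; left.
apply/eqP; apply: eq_bigr => i _; rewrite -exprMn; congr (_ ^+ 2).
rewrite /y /invmx uA -scalemxAl mxE mulrC mulrA divff// mul1r mulmx_adj_col.
by congr (\det _); apply/matrixP => a b; rewrite !mxE.
Qed.

(** * Adjugates and the exchange of one index *)

Definition ffun_upd (n r : nat) (J : {ffun 'I_r -> 'I_n}) (i : 'I_r) (a : 'I_n)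
    : {ffun 'I_r -> 'I_n} :=
  [ffun k => if k == i then a else J k].

Lemma replace_row_rowsub (R : Type) (n r p : nat) (V : 'M[R]_(n, p))
    (J : {ffun 'I_r -> 'I_n}) i a :
  replace_row (rowsub J V) i (row a V) = rowsub (ffun_upd J i a) V.
Proof. by apply/matrixP => k l; rewrite !mxE ffunE; case: eqP. Qed.

Lemma normF_adj_rowsub (R : realType) (n r : nat) (V : 'M[R]_(n, r))
    (J : {ffun 'I_r -> 'I_n}) :
  V^T *m V = 1%:M ->
  normF (\adj (rowsub J V)) ^+ 2 =
  \sum_i \sum_a \det (rowsub (ffun_upd J i a) V) ^+ 2.
Proof.
move=> hV; rewrite -(orthonormal_normF _ hV) normF_sqr exchange_big.
apply: eq_bigr => i _; apply: eq_bigr => a _; congr (_ ^+ 2).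
by rewrite -replace_row_rowsub -mulmx_adj_row -row_mul [RHS]mxE.
Qed.

(** Reindexing by the involution that swaps [a] with the entry [J i]. *)
Lemma sum_ffun_upd (R : nmodType) (n r : nat) (i : 'I_r)
    (D : pred {ffun 'I_r -> 'I_n}) (G : {ffun 'I_r -> 'I_n} -> R) :
  \sum_(J | D J) \sum_a G (ffun_upd J i a) =
  \sum_J \sum_(a | D (ffun_upd J i a)) G J.
Proof.
pose h (p : {ffun 'I_r -> 'I_n} * 'I_n) := (ffun_upd p.1 i p.2, p.1 i).
have updK (J : {ffun 'I_r -> 'I_n}) a :
    ffun_upd (ffun_upd J i a) i (J i) = J.
  by apply/ffunP => k; rewrite !ffunE; case: eqP => // ->.
have hK : involutive h by move=> [J a]; rewrite /h /= updK ffunE eqxx.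
rewrite !pair_big_dep/= (reindex_inj (inv_inj hK))/=.
apply: eq_big => [p|p _]; first by rewrite andbT.
by rewrite updK.
Qed.

(** The admissible a are exactly those that avoid the r - 1 values of [J] at the other positions. *)
Lemma card_ffun_upd_injective (n r : nat) (J : {ffun 'I_r -> 'I_n}) (i : 'I_r) :
  injective J -> (#|[pred a | injectiveb (ffun_upd J i a)]| + r.-1)%N = n.
Proof.
move=> iJ; rewrite (_ : r.-1 = #|J @: [set~ i]%SET|); last first.
  by rewrite card_imset// cardsC1 card_ord.
rewrite -[RHS]card_ord -(cardC (mem (J @: [set~ i]%SET))) addnC; congr (_ + _)%N.
apply: eq_card => a; rewrite !inE; apply/injectiveP/idP => [inj|/imsetP nJ].
  apply/imsetP => -[k]; rewrite !inE => /negbTE ki aJ; have := inj k i.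
  by rewrite !ffunE eqxx ki -aJ => /(_ erefl)/eqP; rewrite ki.
have nJk k : k != i -> a <> J k by move=> ki aJ; apply: nJ; exists k; rewrite ?inE.
move=> k l; rewrite !ffunE.
have [->|ki] := eqVneq k i; have [->|li] := eqVneq l i => //.
- by move/(nJk _ li).
- by move/esym/(nJk _ ki).
- exact: iJ.
Qed.

(** After the exchange, each position i counts det(V_J)^2 once per admissible former index: n - r +
    1 times if the determinant is nonzero, since [J] is then injective. Otherwise the term is zero
    anyway. *)
Lemma sum_normF_adj (R : realType) (n r : nat) (V : 'M[R]_(n, r)) :
  V^T *m V = 1%:M ->
  \sum_(J : {ffun 'I_r -> 'I_n} | injectiveb J)
    normF (\adj (rowsub J V)) ^+ 2 =
  r%:R * (n%:R - r%:R + 1) * r`!%:R.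
Proof.
move=> hV; under eq_bigr do rewrite normF_adj_rowsub//.
rewrite exchange_big/= -(sum_det_sqr hV).
transitivity (\sum_(i < r) (n%:R - r%:R + 1) *
    \sum_(J : {ffun 'I_r -> 'I_n}) \det (rowsub J V) ^+ 2); last first.
  by rewrite sumr_const card_ord -[LHS]mulr_natl mulrA.
apply: eq_bigr => i _; rewrite (sum_ffun_upd i (@injectiveb _ _)
  (fun J => \det (rowsub J V) ^+ 2)) mulr_sumr.
apply: eq_bigr => J _; rewrite sumr_const.
have [->|dJ] := eqVneq (\det (rowsub J V)) 0; first by rewrite expr0n mul0rn mulr0.
have r0 : (0 < r)%N := leq_ltn_trans (leq0n _) (ltn_ord i).
have /(congr1 (fun k => k%:R : R)) :=
  card_ffun_upd_injective i (det_rowsub_injective dJ).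
rewrite natrD => <-; rewrite -[in r%:R](prednK r0) -natr1.
by rewrite opprD addrA addrK subrK mulr_natl.
Qed.

(** Exchanging one index perturbs V_J by a matrix of rank at most 1, so the rank stays below r and
    all minors in [normF_adj_rowsub] vanish. *)
Lemma adj_rowsub_eq0 (R : realType) (n r : nat) (V : 'M[R]_(n, r))
    (J : {ffun 'I_r -> 'I_n}) :
  V^T *m V = 1%:M -> ((\rank (rowsub J V)).+1 < r)%N ->
  normF (\adj (rowsub J V)) ^+ 2 = 0.
Proof.
move=> hV rJ; rewrite normF_adj_rowsub// big1// => i _; rewrite big1// => a _.
apply/eqP; rewrite sqrf_eq0; apply/negPn/negP => dJ.
have : rowsub (ffun_upd J i a) V \in unitmx by rewrite unitmxE unitfE.
rewrite -row_full_unit => /eqP rK.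
have eK : rowsub (ffun_upd J i a) V =
    rowsub J V + delta_mx i 0 *m (row a V - row (J i) V).
  apply/matrixP => k l; rewrite !mxE big_ord1 !mxE eqxx andbT ffunE.
  by case: eqP => [->|_]; rewrite ?mul1r ?mul0r ?addr0// addrC subrK.
have := mxrank_add (rowsub J V) (delta_mx i 0 *m (row a V - row (J i) V)).
rewrite -eK rK => rle.
have := leq_trans rle (leq_add (leqnn _) (mxrankM_maxr _ _)).
move/leq_trans/(_ (leq_add (leqnn _) (rank_leq_row _))).
by rewrite addn1 leqNgt rJ.
Qed.

(** * Spectral norm against Frobenius norm *)

(** Both norms are computed on [M], which has the same norms because [V] is an isometry. Its rows in
    [J] form the identity: they give r in the Frobenius norm but only |x|^2 <= 1 in |M x|^2. On the
    other rows Cauchy-Schwarz bounds |M x|^2 by their Frobenius part. *)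
Lemma specnorm_invmx_rowsub (R : realType) (n r : nat) (V : 'M[R]_(n, r))
    (J : {ffun 'I_r -> 'I_n}) :
  V^T *m V = 1%:M -> \det (rowsub J V) != 0 ->
  specnorm (invmx (rowsub J V)) ^+ 2 <=
  normF (invmx (rowsub J V)) ^+ 2 - r%:R + 1.
Proof.
move=> hV dJ; set B := invmx _.
have iJ := det_rowsub_injective dJ.
have uJ : rowsub J V \in unitmx by rewrite unitmxE unitfE.
set M := V *m B; have JM : rowsub J M = 1%:M.
  by rewrite -mul_rowsub_mx mulmxV.
have split_sum (F : 'I_n -> R) :
    \sum_a F a = \sum_k F (J k) + \sum_(a | a \notin codom J) F a.
  rewrite (bigID (mem (codom J)))/=; congr (_ + _).
  rewrite (eq_bigl (mem (J @: 'I_r))); last first.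
    move=> a; apply/codomP/imsetP => [[k ->]|[k _ ->]]; first by exists k.
    by exists k.
  rewrite big_imset/=; first by apply: eq_bigl => k; rewrite inE.
  by move=> ? ? _ _; exact: iJ.
rewrite -(orthonormal_normF _ hV) -/M normF_sqr split_sum.
have -> : \sum_k \sum_j M (J k) j ^+ 2 = r%:R.
  rewrite -[r in RHS]card_ord -sumr_const; apply: eq_bigr => k _.
  have MJ j : M (J k) j = (k == j)%:R.
    by move/matrixP/(_ k j): JM; rewrite !mxE.
  rewrite (bigD1 k)//= MJ eqxx expr1n big1 ?addr0// => j jk.
  by rewrite MJ eq_sym (negbTE jk) expr0n.
rewrite [r%:R + _ - _]addrAC subrr add0r addrC.
apply: specnorm_sqr_le => x x1.
have x2 : norm2 x ^+ 2 <= 1 by rewrite expr_le1// sqrtr_ge0.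
rewrite -(orthonormal_norm2 _ hV) mulmxA -/M norm2_sqr split_sum; apply: lerD.
  have -> : \sum_k (M *m x) (J k) 0 ^+ 2 = norm2 x ^+ 2; last by [].
  rewrite norm2_sqr; apply: eq_bigr => k _; congr (_ ^+ 2).
  have -> : (M *m x) (J k) 0 = (rowsub J M *m x) k 0.
    by rewrite mul_rowsub_mx [RHS]mxE.
  by rewrite JM mul1mx.
apply: ler_sum => a _; rewrite mxE; apply: (le_trans (cauchy_schwarz_sum _ _)).
by rewrite ler_piMr -?norm2_sqr// sumr_ge0// => j _; exact: sqr_ge0.
Qed.

(** * The expectation bounds *)

Theorem corollary3p1 (R : realType) (d : measure_display)
    (T : measurableType d) (P : probability T R) (n r : nat)
    (V : 'M[R]_(n, r)) (hV : V^T *m V = 1%:M)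
    (I : T -> r.-tuple 'I_n) (u : forall k : 'I_r, T -> 'cV[R]_(r - k))
    (W : nat -> T -> 'M[R]_(n, r)) (hI : is_ARP P V I u W) :
  let E_I := fun w : T => unit_cols R (I w) in
  (forall f : 'cV[R]_n,
     'E_P[fun w => (norm2 (f - V *m invmx ((E_I w)^T *m V) *m
                               (E_I w)^T *m f) ^+ 2)%R]
      <= ((r%:R + 1) * norm2 (f - V *m V^T *m f) ^+ 2)%:E)%E /\
  (('E_P[fun w => (normF (invmx ((E_I w)^T *m V)) ^+ 2)%R]
      <= (r%:R * (n%:R - r%:R + 1))%:E)%E /\
   (no_corank1_rows V ->
    'E_P[fun w => (normF (invmx ((E_I w)^T *m V)) ^+ 2)%R]%E
      = (r%:R * (n%:R - r%:R + 1))%:E)) /\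
  ('E_P[fun w => (specnorm (invmx ((E_I w)^T *m V)) ^+ 2)%R]
      <= (r%:R * (n%:R - r%:R) + 1)%:E)%E.
Proof.
move=> E_I; have rf0 : 0 < r`!%:R :> R by rewrite ltr0n fact_gt0.
have subE (J : {ffun 'I_r -> 'I_n}) p (M : 'M[R]_(n, p)) :
    (unit_cols R (mktuple J))^T *m M = rowsub J M.
  by rewrite mul_tr_unit_cols rowsub_mktuple.
(* On a singular matrix [invmx] returns its argument; the zero weight removes this default value. *)
have normF_det (J : {ffun 'I_r -> 'I_n}) :
    normF (invmx (rowsub J V)) ^+ 2 * \det (rowsub J V) ^+ 2 =
    if \det (rowsub J V) != 0 then normF (\adj (rowsub J V)) ^+ 2 else 0.
  case: ifPn => [dJ|/negPn/eqP->]; last by rewrite expr0n mulr0.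
  rewrite /invmx unitmxE unitfE dJ normFZ exprVn mulrAC mulVf ?mul1r//.
  by rewrite sqrf_eq0.
have normF_EE := arp_expectation hV hI
  (F := fun J => normF (invmx ((unit_cols R J)^T *m V)) ^+ 2)
  (fun=> sqr_ge0 _).
(* An inequality, since [sum_normF_adj] also counts the adjugates of singular V_J with distinct
   indices. *)
have normF_sum_le : \sum_(J : {ffun 'I_r -> 'I_n})
    normF (invmx (rowsub J V)) ^+ 2 * \det (rowsub J V) ^+ 2 <=
    r%:R * (n%:R - r%:R + 1) * r`!%:R.
  rewrite -(sum_normF_adj hV) [leRHS]big_mkcond/=; apply: ler_sum => J _.
  rewrite normF_det; case: ifPn => [dJ|_]; last by case: ifP => // _; exact: sqr_ge0.
  by have /injectiveP-> := det_rowsub_injective dJ.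
split; last split; first move=> f.
- rewrite (_ : (fun w => _) = (fun w => norm2 (f - V *m
      invmx ((unit_cols R (I w))^T *m V) *m ((unit_cols R (I w))^T *m f)) ^+ 2));
    last by apply/funext => w; rewrite !mulmxA.
  rewrite (arp_expectation hV hI (F := fun J => norm2 (f - V *m
      invmx ((unit_cols R J)^T *m V) *m ((unit_cols R J)^T *m f)) ^+ 2)
    (fun=> sqr_ge0 _)) lee_fin ler_pdivrMr//.
  under eq_bigr do rewrite !subE.
  apply: (le_trans (ler_sum _ (fun J _ => oblique_projection_bound J f hV))).
  (* The residual itself contributes r! |g|^2 and so does each of the r replaced columns, whence r +
     1. *)
  rewrite big_split/= -mulr_sumr sum_det_sqr// exchange_big/=.
  under [X in _ + X]eq_bigr => i _.
    rewrite sum_det_replace_col//; last first.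
      by rewrite mulmxBr !mulmxA hV mul1mx subrr.
    over.
  rewrite sumr_const card_ord -mulr_natl le_eqVlt; apply/orP; left.
  by apply/eqP; ring.
- rewrite normF_EE; under eq_bigr do rewrite subE.
  split; first by rewrite lee_fin ler_pdivrMr.
  move=> hr; congr EFin; apply: (canLR (mulfK (lt0r_neq0 rf0))).
  rewrite -(sum_normF_adj hV) [RHS]big_mkcond/=; apply: eq_bigr => J _.
  rewrite normF_det; case: ifPn => [dJ|/negPn dJ].
    by have /injectiveP-> := det_rowsub_injective dJ.
  (* A singular V_J has rank below r, and the hypothesis excludes r - 1, so its adjugate is zero. *)
  case: ifPn => // /injectiveP iJ; rewrite adj_rowsub_eq0//.
  have uJ : uniq (mktuple J) by rewrite map_inj_uniq ?enum_uniq.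
  have := hr _ uJ; rewrite subE => /eqP rk1; rewrite ltn_neqAle rk1/=.
  rewrite ltn_neqAle rank_leq_row andbT; apply/negP => /eqP rkr.
  have : rowsub J V \in unitmx by rewrite -row_full_unit; apply/eqP.
  by rewrite unitmxE (eqP dJ) unitr0.
- rewrite (arp_expectation hV hI
    (F := fun J => specnorm (invmx ((unit_cols R J)^T *m V)) ^+ 2)
    (fun=> sqr_ge0 _)) lee_fin ler_pdivrMr//.
  under eq_bigr do rewrite subE.
  (* Since the weights sum to r!, the correction 1 - r can be spread over the index sets, which
     allows a termwise comparison. *)
  have -> : (r%:R * (n%:R - r%:R) + 1) * r`!%:R =
      r%:R * (n%:R - r%:R + 1) * r`!%:R +
      (1 - r%:R) * \sum_(J : {ffun 'I_r -> 'I_n}) \det (rowsub J V) ^+ 2 :> R.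
    by rewrite sum_det_sqr//; ring.
  apply: le_trans (lerD normF_sum_le (lexx _)).
  rewrite mulr_sumr -big_split/=; apply: ler_sum => J _; rewrite -mulrDl.
  have [->|dJ] := eqVneq (\det (rowsub J V)) 0; first by rewrite expr0n !mulr0.
  rewrite ler_wpM2r ?sqr_ge0// [1 - _]addrC addrA.
  exact: specnorm_invmx_rowsub.
Qed.
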